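(* Let $\{x^k\}$ be generated by the MCondG algorithm with the tight adaptive step size $t_k=t_k^{\rm TAS}$. Let $i_*\in\langle m\rangle$ be an index such that $f_{i_*}(x^0)-f_{i_*}^{\inf}=\min\{f_i(x^0)-f_i^{\inf}:i\in\langle m\rangle\}$. Then there exists $\widehat{L}\in(0,L_{\max}]$ such that (i) $\lim_{k\to\infty}\theta(x^k)=0$; (ii) for every integer $N\ge1$, $$\min\{|\theta(x^k)|:k=0,1,\dots,N-1\}\le\max\left\{\frac{2(f_{i_*}(x^0)-f_{i_*}^{\inf})}{N},\; D\sqrt{\frac{2\widehat{L}(f_{i_*}(x^0)-f_{i_*}^{\inf})}{N}}\right\}.$$
   Context: Notation: $\langle m\rangle=\{1,2,\dots,m\}$; $\langle\cdot,\cdot\rangle$ and $\|\cdot\|$ are the standard inner product and Euclidean norm on $\mathbb{R}^n$. Problem: $F=(f_1,\dots,f_m)^\top:\mathbb{R}^n\to\mathbb{R}^m$ is continuously differentiable (no convexity is assumed) and $\Omega\subset\mathbb{R}^n$ is a nonempty compact convex set with diameter $D=\max\{\|x-y\|:x,y\in\Omega\}$. For each $i\in\langle m\rangle$ there is a constant $L_i>0$ with $\|\nabla f_i(x)-\nabla f_i(y)\|\le L_i\|x-y\|$ for all $x,y\in\Omega$. Put $L_{\max}=\max_{i\in\langle m\rangle}L_i$ and $f_i^{\inf}=\inf\{f_i(x):x\in\Omega\}$. For $x\in\Omega$, let $p(x)\in\arg\min_{p\in\Omega}\max_{i\in\langle m\rangle}\langle\nabla f_i(x),p-x\rangle$ (some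 minimizer), $d(x)=p(x)-x$, and $\theta(x)=\max_{i\in\langle m\rangle}\langle\nabla f_i(x),p(x)-x\rangle$. The multiobjective conditional gradient (MCondG) algorithm starts from $x^0\in\Omega$ and iterates $x^{k+1}=x^k+t_kd^k$ with $d^k=d(x^k)$ and a step size $t_k\in(0,1]$; it stops if $\theta(x^k)=0$. It is assumed that it does not terminate, i.e. $\theta(x^k)<0$ for all $k\ge0$ (in particular $d^k\neq0$). For $t\in[0,1]$ define $$g_{i,k}(t)=\tfrac12L_i\|d^k\|^2t^2+\langle\nabla f_i(x^k),d^k\rangle t\quad(i\in\langle m\rangle),\qquad g_k(t)=\max_{i\in\langle m\rangle}g_{i,k}(t).$$ The tight adaptive step size $t_k^{\rm TAS}$ is the unique minimizer of $g_k$ over $[0,1]$. *)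

(* Defs.v *)
From HB Require Import structures.
From mathcomp Require Import all_boot all_order all_algebra.
From mathcomp Require Import all_classical all_reals all_analysis.

Set Implicit Arguments.
Unset Strict Implicit.
Unset Printing Implicit Defensive.

Import Order.TTheory GRing.Theory Num.Theory.
Import numFieldNormedType.Exports.

Local Open Scope classical_set_scope.
Local Open Scope ring_scope.

Section Defs.
Variable R : realType.

(* The library norm `|u| on 'rV[R]_n is the sup norm, hence a separate
   Euclidean norm; both induce the same topology. *)
Definition dotv n (u v : 'rV[R]_n) : R := \sum_(j < n) u 0 j * v 0 j.

Definition enorm n (u : 'rV[R]_n) : R := Num.sqrt (dotv u u).

(* The default value of the iterated operators is a member of the family, so
   these are the true maximum and minimum. *)
Definition fmax m (a : 'I_m.+1 -> R) : R := \big[Num.max/a ord0]_(i < m.+1) a i.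

Definition fmin m (a : 'I_m.+1 -> R) : R := \big[Num.min/a ord0]_(i < m.+1) a i.

Definition is_max (A : set R) (M : R) : Prop := A M /\ ubound A M.

Definition is_argmin (T : Type) (A : set T) (g : T -> R) (a : T) : Prop :=
  A a /\ forall b, A b -> g a <= g b.

Definition grad n (f : 'rV[R]_n -> R) (y : 'rV[R]_n) : 'rV[R]_n :=
  \row_(j < n) 'D_(delta_mx 0 j) f y.

Definition continuously_differentiable n m (F : 'rV[R]_n -> 'rV[R]_m) : Prop :=
  (forall y, differentiable F y) /\ continuous (fun y => 'J F y).

Section MCondG.
Variables (n m : nat) (F : 'rV[R]_n -> 'rV[R]_m.+1) (Omega : set 'rV[R]_n).

Definition component (i : 'I_m.+1) (y : 'rV[R]_n) : R := F y 0 i.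

Definition finf (i : 'I_m.+1) : R := inf (component i @` Omega).

Definition linmax (y v : 'rV[R]_n) : R :=
  fmax (fun i => dotv (grad (component i) y) v).

Definition selects_minimizer (p : 'rV[R]_n -> 'rV[R]_n) : Prop :=
  forall y, Omega y -> is_argmin Omega (fun q => linmax y (q - y)) (p y).

Definition direction (p : 'rV[R]_n -> 'rV[R]_n) (y : 'rV[R]_n) : 'rV[R]_n :=
  p y - y.

Definition theta (p : 'rV[R]_n -> 'rV[R]_n) (y : 'rV[R]_n) : R :=
  linmax y (p y - y).

Definition MCondG_iterates (p : 'rV[R]_n -> 'rV[R]_n) (t : nat -> R)
    (x : nat -> 'rV[R]_n) : Prop :=
  [/\ Omega (x 0%N),
      forall k, 0 < t k <= 1
    & forall k, x k.+1 = x k + t k *: direction p (x k)].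

Definition quad_model (L : 'I_m.+1 -> R) (y d : 'rV[R]_n) (i : 'I_m.+1)
    (s : R) : R :=
  2^-1 * L i * enorm d ^+ 2 * s ^+ 2 + dotv (grad (component i) y) d * s.

(* The minimizer is unique when d != 0 and all L i > 0 (strict convexity). *)
Definition is_TAS_step (L : 'I_m.+1 -> R) (y d : 'rV[R]_n) (s : R) : Prop :=
  is_argmin `[0, 1] (fun r => fmax (fun i => quad_model L y d i r)) s.

End MCondG.
End Defs.

(* Main.v *)
Require Import Defs.
From HB Require Import structures.
From mathcomp Require Import all_boot all_order all_algebra.
From mathcomp Require Import all_classical all_reals all_analysis.
From mathcomp Require Import ring lra.

(* Write f_i for the components of F, L = max_i L_i and d = d^k. Along the
   segment from x^k to p(x^k) the descent lemma gives
   f_i(x^k + t d) - f_i(x^k) <= g_{i,k}(t), and t_k minimizes max_i g_{i,k}, so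
   for every i and every s in [0, 1]
     f_i(x^k) - f_i(x^{k+1}) >= |theta(x^k)| s - L D^2 s^2 / 2.
   Taking s = min(1, |theta(x^k)| / (L D^2)) yields
     |theta(x^k)| <= max(2 delta, D sqrt(2 L delta)),
     delta = f_i(x^k) - f_i(x^{k+1}).
   The decreases delta tend to 0 because f_i(x^k) is nonincreasing and bounded
   below, which is (i); their sum over k < N is at most f_i(x^0) - inf f_i, so
   one of them is at most a 1/N fraction of it, which is (ii). Hence the choice
   L_max for the constant of the theorem works. *)

Set Implicit Arguments.
Unset Strict Implicit.
Unset Printing Implicit Defensive.

Import Order.TTheory GRing.Theory Num.Theory.
Import numFieldNormedType.Exports.

Local Open Scope classical_set_scope.
Local Open Scope ring_scope.

(** * Euclidean inner product and the Cauchy-Schwarz inequality *)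

Section EuclideanSpace.
Variables (R : realType) (n : nat).
Implicit Types u v w : 'rV[R]_n.

Lemma dotvBl u w v : dotv (u - w) v = dotv u v - dotv w v.
Proof.
rewrite /dotv -sumrB; apply: eq_bigr => j _.
by rewrite !mxE mulrBl.
Qed.

Lemma dotvv_ge0 u : 0 <= dotv u u.
Proof. by apply: sumr_ge0 => j _; rewrite -expr2 sqr_ge0. Qed.

Lemma enorm_ge0 u : 0 <= enorm u.
Proof. exact: sqrtr_ge0. Qed.

Lemma sqr_enorm u : enorm u ^+ 2 = dotv u u.
Proof. by rewrite sqr_sqrtr// dotvv_ge0. Qed.

Lemma enormZ (a : R) u : enorm (a *: u) = `|a| * enorm u.
Proof.
rewrite /enorm -sqrtr_sqr -sqrtrM ?sqr_ge0//; congr Num.sqrt.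
rewrite /dotv mulr_sumr; apply: eq_bigr => j _.
by rewrite !mxE; ring.
Qed.

Lemma dotvv_eq0 u : dotv u u = 0 -> u = 0.
Proof.
move=> u0; apply/rowP => j; rewrite mxE.
have sq_ge0 k : true -> 0 <= u 0 k * u 0 k by rewrite -expr2 sqr_ge0.
by have /eqP := (@psumr_eq0P _ _ _ _ sq_ge0 u0 j isT); rewrite mulf_eq0 orbb => /eqP.
Qed.

Lemma dotv0 v : dotv v 0 = 0.
Proof. by rewrite /dotv big1// => j _; rewrite mxE mulr0. Qed.

Lemma dotv_sqrB (a b : R) u v : dotv (a *: u - b *: v) (a *: u - b *: v) =
  a ^+ 2 * dotv u u - (a * b * dotv u v) *+ 2 + b ^+ 2 * dotv v v.
Proof.
rewrite /dotv !mulr_sumr -sumrMnl -sumrB -big_split/=.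
by apply: eq_bigr => j _; rewrite !mxE; ring.
Qed.

Lemma cauchy_schwarz_dotv u v : dotv u v <= enorm u * enorm v.
Proof.
have [v0|v_neq0] := eqVneq (dotv v v) 0.
  by rewrite (dotvv_eq0 v0) dotv0 mulr_ge0 ?enorm_ge0.
have v_gt0 : 0 < dotv v v by rewrite lt0r v_neq0 dotvv_ge0.
rewrite -sqrtrM ?dotvv_ge0//; apply: le_trans (ler_norm _) _.
rewrite -sqrtr_sqr ler_sqrt ?mulr_ge0 ?dotvv_ge0//.
(* This vector is <v,v> times the component of u orthogonal to v. Its squared norm factors as <v,v>
   (<u,u><v,v> - <u,v>^2), and dividing by <v,v> > 0 leaves the claim. *)
have := dotvv_ge0 (dotv v v *: u - dotv u v *: v).
rewrite dotv_sqrB (_ : _ + _ = dotv v v * (dotv u u * dotv v v - dotv u v ^+ 2)).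
  by rewrite pmulr_rge0// subr_ge0.
by ring.
Qed.

End EuclideanSpace.

(** * Derivatives along lines and the descent lemma *)

Section Descent.
Variables (R : realType) (n : nat).
Implicit Types (f : 'rV[R]_n -> R) (y d : 'rV[R]_n).

(** The differential is linear, so it can be evaluated on the expansion of d in the canonical
    basis. *)
Lemma derive_grad f y d : differentiable f y -> 'D_d f y = dotv (grad f y) d.
Proof.
move=> dfy; rewrite deriveE// [in LHS](row_sum_delta d) linear_sum/=.
by apply: eq_bigr => j _; rewrite linearZ/= mxE deriveE// mulrC.
Qed.

Lemma is_derive_line f y d (r : R) : differentiable f (y + r *: d) ->
  is_derive r 1 (fun s => f (y + s *: d)) (dotv (grad f (y + r *: d)) d).
Proof.
move=> dfr; rewrite -derive_grad//.
(* The difference quotient of the restriction at r is that of f at y + r d in direction d, so the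
   two derivatives agree without a chain rule. *)
have E : (fun h : R => h^-1 *: (f (y + (h *: 1 + r) *: d) - f (y + r *: d)))
    = (fun h : R => h^-1 *: (f (h *: d + (y + r *: d)) - f (y + r *: d))).
  by apply/funext => h; rewrite [h *: 1]mulr1 scalerDl addrCA.
have := @diff_derivable _ _ _ _ _ d dfr.
split; first by rewrite /derivable [X in X @ _]E.
by rewrite /derive [X in X @ _]E.
Qed.

(** Along the segment, f minus the quadratic model has derivative <grad f(y + r d) - grad f(y), d> -
    L ||d||^2 r. Cauchy-Schwarz and the Lipschitz bound, applicable because the segment stays in
    [Omega], make it nonpositive, so the difference is largest at 0. *)
Lemma descent_lemma f (Omega : set 'rV[R]_n) (L : R) y d (s : R) :
    (forall z, differentiable f z) ->
    (forall z w, Omega z -> Omega w ->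
      enorm (grad f z - grad f w) <= L * enorm (z - w)) ->
    (forall r, 0 <= r <= 1 -> Omega (y + r *: d)) -> 0 <= s <= 1 ->
  f (y + s *: d) <=
    f y + (2^-1 * L * enorm d ^+ 2 * s ^+ 2 + dotv (grad f y) d * s).
Proof.
move=> df fL Oyd /andP[s0 s1].
pose q : R -> R :=
  (2^-1 * L * enorm d ^+ 2) *: @id R ^+ 2 + dotv (grad f y) d *: @id R.
pose h : R -> R := (fun r => f (y + r *: d)) - q.
have dh (r : R) : is_derive r 1 h (dotv (grad f (y + r *: d)) d
    - (L * enorm d ^+ 2 * r + dotv (grad f y) d)).
  apply: is_deriveB; first exact: is_derive_line.
  rewrite /q; apply: is_derive_eq.
  by rewrite /GRing.scale/=; field.
have hc : {within `[0, 1], continuous h}.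
  apply: continuous_subspaceT => r; apply/differentiable_continuous.
  by apply/derivable1_diffP; case: (dh r).
have : h s <= h 0.
  apply: (ler0_derive1_le_cc _ _ hc) => //; rewrite ?in_itv/= ?lexx ?s0 ?s1 ?ler01//.
  move=> r; rewrite in_itv/= => /andP[r0 r1].
  rewrite derive1E (@derive_val _ _ _ _ _ _ _ (dh r)).
  rewrite [X in _ - X]addrC opprD addrA -dotvBl subr_le0.
  apply: le_trans (cauchy_schwarz_dotv _ _) _.
  have Oy : Omega y by have := Oyd 0; rewrite scale0r addr0; apply; rewrite lexx ler01.
  have := fL _ _ (Oyd r _) Oy.
  rewrite (ltW r0) (ltW r1) => /(_ isT).
  rewrite [y + _]addrC addrK enormZ (gtr0_norm r0) => H.
  have := ler_wpM2r (enorm_ge0 d) H.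
  by move=> /le_trans; apply; lra.
have hE r : h r = f (y + r *: d)
    - (2^-1 * L * enorm d ^+ 2 * r ^+ 2 + dotv (grad f y) d * r) by [].
rewrite !hE scale0r addr0; lra.
Qed.

End Descent.

(** * Segments, maxima, infima and a scalar inequality *)

Lemma convex_set_segment (R : realType) (V : lmodType R) (A : set V) (y z : V)
    (s : R) : convex_set A -> A y -> A z -> 0 <= s <= 1 ->
  A (y + s *: (z - y)).
Proof.
move=> cA Ay Az /andP[s0 s1].
have := cA z y (Itv01 s0 s1); rewrite !inE => /(_ Az Ay).
by rewrite /conv/= scalerBr scalerBl scale1r addrCA.
Qed.

Section Fmax.
Variables (R : realType) (m : nat).
Implicit Type a : 'I_m.+1 -> R.

Lemma le_fmax a i : a i <= fmax a.
Proof. exact: le_bigmax. Qed.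

Lemma fmax_le a (b : R) : (forall i, a i <= b) -> fmax a <= b.
Proof. by move=> ab; exact: bigmax_le. Qed.

End Fmax.

(** [inf] is a lower bound only for sets bounded below; the minimum attained on the compact set
    provides such a bound. *)
Lemma ge_inf_compact (R : realType) (T : topologicalType) (A : set T)
    (f : T -> R) (z : T) :
  compact A -> continuous f -> A z -> inf (f @` A) <= f z.
Proof.
move=> cA cf Az; apply: ge_inf; last by exists z.
have [c _ fc] := compact_EVT_min (ex_intro _ z Az) cA
  (continuous_subspaceT cf).
by exists (f c) => _ [w Aw <-]; apply: fc; rewrite inE.
Qed.

Lemma le_max_of_quadratic_decrease (R : realType) (v L D delta : R) :
    0 <= v -> 0 < L -> 0 < D ->
    (forall s, 0 <= s <= 1 -> v * s - 2^-1 * L * D ^+ 2 * s ^+ 2 <= delta) ->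
  v <= Num.max (2 * delta) (D * Num.sqrt (2 * L * delta)).
Proof.
move=> v0 L0 D0 H; rewrite le_max.
have C0 : 0 < L * D ^+ 2 by rewrite mulr_gt0// exprn_gt0.
(* The quadratic peaks at s = v / (L D^2). If this is at least 1, then s = 1 already gives v - L D^2
   / 2 >= v / 2. *)
have [Cv|vC] := leP (L * D ^+ 2) v.
  by have := H 1; rewrite ler01 lexx => /(_ isT); lra.
have sP : 0 <= v / (L * D ^+ 2) <= 1.
  by rewrite divr_ge0 ?(ltW C0)//= ler_pdivrMr// mul1r ltW.
apply/orP; right.
rewrite -[X in X <= _](ger0_norm v0) -sqrtr_sqr -[D in _ <= D * _](gtr0_norm D0).
rewrite -sqrtr_sqr -sqrtrM ?sqr_ge0// ler_wsqrtr//.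
(* The peak value is v^2 / (2 L D^2); solving for v^2 exhibits the quadratic at an admissible s,
   where it is at most [delta]. *)
have -> : v ^+ 2 = 2 * (L * D ^+ 2) * (v * (v / (L * D ^+ 2))
    - 2^-1 * L * D ^+ 2 * (v / (L * D ^+ 2)) ^+ 2).
  by field; rewrite !gt_eqF.
have -> : D ^+ 2 * (2 * L * delta) = 2 * (L * D ^+ 2) * delta by ring.
by rewrite ler_pM2l ?mulr_gt0 ?H.
Qed.

(** * Decrease and convergence along the iterates *)

Section MCondG.
Variables (R : realType) (n m : nat).
Variables (F : 'rV[R]_n -> 'rV[R]_m.+1) (Omega : set 'rV[R]_n).
Variables (D : R) (L : 'I_m.+1 -> R).
Variables (p : 'rV[R]_n -> 'rV[R]_n) (t : nat -> R) (x : nat -> 'rV[R]_n).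
Hypothesis hF : continuously_differentiable F.
Hypothesis hOmegaK : compact Omega.
Hypothesis hOmegaC : convex_set Omega.
Hypothesis hD :
  is_max [set r | exists y z, [/\ Omega y, Omega z & r = enorm (y - z)]] D.
Hypothesis hL0 : forall i, 0 < L i.
Hypothesis hL : forall i y z, Omega y -> Omega z ->
  enorm (grad (component F i) y - grad (component F i) z)
    <= L i * enorm (y - z).
Hypothesis hp : selects_minimizer F Omega p.
Hypothesis hx : MCondG_iterates Omega p t x.
Hypothesis hnonterm : forall k, theta F p (x k) < 0.
Hypothesis ht : forall k, is_TAS_step F L (x k) (direction p (x k)) (t k).

Local Notation f := (component F).
Local Notation d k := (direction p (x k)).
Local Notation theta k := (theta F p (x k)).

Lemma differentiable_component i y : differentiable (f i) y.
Proof.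
apply: (@differentiable_comp _ _ _ _ F (fun M => M 0 i)); first exact: hF.1.
exact: differentiable_coord.
Qed.

Lemma iterate_feasible k : Omega (x k).
Proof.
have [x0 t01 xS] := hx; elim: k => // k IH.
rewrite xS; apply: convex_set_segment => //; first by case: (hp IH).
by have /andP[/ltW-> ->] := t01 k.
Qed.

Lemma finf_le i k : finf F Omega i <= f i (x k).
Proof.
apply: ge_inf_compact => //; last exact: iterate_feasible.
by move=> y; exact/differentiable_continuous/differentiable_component.
Qed.

Lemma enorm_direction_le k : enorm (d k) <= D.
Proof.
apply: hD.2; exists (p (x k)), (x k); split => //; last exact: iterate_feasible.
by case: (hp (iterate_feasible k)).
Qed.

Lemma direction_neq0 k : d k != 0.
Proof.
apply/eqP => d0; have := hnonterm k; rewrite ltNge => /negP; apply.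
rewrite /Defs.theta /linmax -/(d k) d0; apply: le_trans (le_fmax _ ord0).
by rewrite dotv0.
Qed.

(** Nontermination makes the first direction nonzero, and its norm is at most D. *)
Lemma diameter_gt0 : 0 < D.
Proof.
apply: lt_le_trans (enorm_direction_le 0).
rewrite lt0r enorm_ge0 andbT; apply: contra_neq (direction_neq0 0) => e0.
by apply: dotvv_eq0; rewrite -sqr_enorm e0 expr0n.
Qed.

Lemma fmaxL_gt0 : 0 < fmax L.
Proof. exact: lt_le_trans (hL0 ord0) (le_fmax _ _). Qed.

Lemma component_decrease i k (s : R) : 0 <= s <= 1 ->
  `|theta k| * s - 2^-1 * fmax L * D ^+ 2 * s ^+ 2 <= f i (x k) - f i (x k.+1).
Proof.
move=> s01; have [_ t01 xS] := hx.
have Ok := iterate_feasible k; have [Op _] := hp Ok.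
have seg r : 0 <= r <= 1 -> Omega (x k + r *: d k).
  by move=> r01; exact: convex_set_segment.
have tk01 : 0 <= t k <= 1 by have /andP[/ltW-> ->] := t01 k.
have desc := descent_lemma (differentiable_component i) (hL i) seg tk01.
(* Optimality of the step: the largest model value at [t k] is at most that at s, and it dominates
   the model of the fixed index i. *)
have [_ /(_ s)] := ht k; rewrite /= in_itv/= => /(_ s01) tmin.
have := le_trans (le_fmax (quad_model F L (x k) (d k) ^~ (t k)) i) tmin.
set M := fmax _ => leM.
(* Each model is bounded termwise: its curvature through L_j <= L_max and ||d^k|| <= D, its slope by
   theta, using s >= 0. *)
have : M <= 2^-1 * fmax L * D ^+ 2 * s ^+ 2 + theta k * s.
  have /andP[s0 s1] := s01.
  apply: fmax_le => j; apply: lerD.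
    rewrite ler_wpM2r ?sqr_ge0// ler_pM ?sqr_ge0 ?mulr_ge0 ?(ltW (hL0 j))//.
      by rewrite ler_wpM2l// le_fmax.
    by rewrite ler_sqr ?nnegrE ?enorm_ge0 ?(ltW diameter_gt0)// enorm_direction_le.
  by rewrite ler_wpM2r// (le_fmax (fun j => dotv (grad (f j) (x k)) (d k))).
rewrite xS ltr0_norm//; move: desc leM; rewrite /quad_model.
lra.
Qed.

Lemma abs_theta_le i k : `|theta k| <= Num.max (2 * (f i (x k) - f i (x k.+1)))
  (D * Num.sqrt (2 * fmax L * (f i (x k) - f i (x k.+1)))).
Proof.
apply: le_max_of_quadratic_decrease => //; first exact: fmaxL_gt0.
  exact: diameter_gt0.
by move=> s; exact: component_decrease.
Qed.

(** At s = 0 the lower bound on the decrease vanishes. *)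
Lemma component_nonincreasing i k : f i (x k.+1) <= f i (x k).
Proof.
have := @component_decrease i k 0; rewrite lexx ler01 => /(_ isT).
by rewrite expr0n !mulr0 subr0 subr_ge0.
Qed.

Lemma theta_cvg0 : (fun k => theta k) @ \oo --> (0 : R).
Proof.
pose u k := f ord0 (x k).
have u_cvg : cvgn u.
  apply: nonincreasing_is_cvgn; last first.
    by exists (finf F Omega ord0) => _ [k _ <-]; exact: finf_le.
  by apply/nonincreasing_seqP => k; exact: component_nonincreasing.
have du_cvg : (u k - u k.+1) @[k --> \oo] --> (0 : R).
  rewrite -(subrr (limn u)); apply: cvgB; first exact: u_cvg.
  by rewrite (cvg_shiftS u).
apply: norm_cvg0.
(* The maximum of two nonnegative terms is at most their sum, whose limit follows from continuity of
   the square root. *)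
apply: (@squeeze_cvgr _ _ _ _ (cst 0)
  (fun k => 2 * (u k - u k.+1) + D * Num.sqrt (2 * fmax L * (u k - u k.+1)))).
- near=> k; rewrite normr_ge0/=.
  apply: le_trans (abs_theta_le ord0 k) _.
  have du0 : 0 <= u k - u k.+1 by rewrite subr_ge0 component_nonincreasing.
  rewrite ge_max lerDl lerDr !mulr_ge0 ?sqrtr_ge0//.
  exact/ltW/diameter_gt0.
- exact: cvg_cst.
- have lim0 : 2 * 0 + D * Num.sqrt (2 * fmax L * 0) = 0 :> R.
    by rewrite !mulr0 sqrtr0 mulr0 addr0.
  rewrite -[X in _ --> X]lim0.
  apply: cvgD; first by apply: cvgM; [exact: cvg_cst | exact: du_cvg].
  apply: cvgM; first exact: cvg_cst.
  apply: (@continuous_cvg _ _ _ _ _ _ Num.sqrt); first exact: sqrt_continuous.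
  by apply: cvgM; [exact: cvg_cst | exact: du_cvg].
Unshelve. all: by end_near. Qed.

(** Otherwise the N decreases would sum to more than f_i(x^0) - inf f_i, yet they telescope to
    f_i(x^0) - f_i(x^N). *)
Lemma exists_small_decrease i N : (1 <= N)%N -> exists2 k, (k < N)%N &
  f i (x k) - f i (x k.+1) <= (f i (x 0%N) - finf F Omega i) / N%:R.
Proof.
move=> N1; apply/not_exists2P => H.
have N0 : 0 < N%:R :> R by rewrite ltr0n.
have : \sum_(0 <= k < N) (f i (x 0%N) - finf F Omega i) / N%:R
    < \sum_(0 <= k < N) (f i (x k) - f i (x k.+1)).
  apply: ltr_sum_nat => // k /andP[_ kN].
  by rewrite ltNge; apply/negP; case: (H k).
rewrite sumr_const_nat subn0 -[_ *+ N]mulr_natr divfK ?gt_eqF//.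
rewrite (telescope_sumr_eq (fun k => - f i (x k)))//; last first.
  by move=> k _; rewrite opprK addrC.
by have := finf_le i N; lra.
Qed.

(** The default of the iterated minimum is the term k = 0, a member of the family since N >= 1. The
    bound on |theta| is monotone in the decrease, so it can be applied at an index of small
    decrease. *)
Lemma min_abs_theta_le i N : (1 <= N)%N ->
  \big[Num.min/`|theta 0%N|]_(k < N) `|theta k|
  <= Num.max (2 * (f i (x 0%N) - finf F Omega i) / N%:R)
       (D * Num.sqrt
          (2 * fmax L * (f i (x 0%N) - finf F Omega i) / N%:R)).
Proof.
move=> N1; have [k kN dec] := exists_small_decrease i N1.
apply: le_trans (bigmin_le _ (Ordinal kN) _) _.
apply: le_trans (abs_theta_le i k) _.
rewrite -!mulrA; apply: le_max2; first by rewrite ler_pM2l// mulrA.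
rewrite ler_wpM2l ?(ltW diameter_gt0)// ler_wsqrtr// ler_pM2l//.
by rewrite ler_wpM2l ?(ltW fmaxL_gt0).
Qed.

End MCondG.

Theorem theorem4p3 (R : realType) (n m : nat)
    (F : 'rV[R]_n -> 'rV[R]_m.+1) (Omega : set 'rV[R]_n)
    (D : R) (L : 'I_m.+1 -> R)
    (p : 'rV[R]_n -> 'rV[R]_n) (t : nat -> R) (x : nat -> 'rV[R]_n)
    (istar : 'I_m.+1)
    (hF : continuously_differentiable F)
    (hOmega0 : Omega !=set0) (hOmegaK : compact Omega)
    (hOmegaC : convex_set Omega)
    (hD : is_max [set r | exists y z, [/\ Omega y, Omega z & r = enorm (y - z)]] D)
    (hL0 : forall i, 0 < L i)
    (hL : forall i y z, Omega y -> Omega z ->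
      enorm (grad (component F i) y - grad (component F i) z)
        <= L i * enorm (y - z))
    (hp : selects_minimizer F Omega p)
    (hx : MCondG_iterates Omega p t x)
    (hnonterm : forall k, theta F p (x k) < 0)
    (ht : forall k, is_TAS_step F L (x k) (direction p (x k)) (t k))
    (histar : component F istar (x 0%N) - finf F Omega istar
      = fmin (fun i => component F i (x 0%N) - finf F Omega i)) :
  exists Lhat : R,
    [/\ 0 < Lhat <= fmax L,
        (fun k => theta F p (x k)) @ \oo --> (0 : R)
      & forall N : nat, (1 <= N)%N ->
          \big[Num.min/`|theta F p (x 0%N)|]_(k < N) `|theta F p (x k)|
          <= Num.max
               (2 * (component F istar (x 0%N) - finf F Omega istar) / N%:R)
               (D * Num.sqrt
                  (2 * Lhat * (component F istar (x 0%N) - finf F Omega istar)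
                     / N%:R))].
Proof.
exists (fmax L); split; first by rewrite lexx (fmaxL_gt0 hL0).
- exact: (theta_cvg0 hF hOmegaK hOmegaC hD hL0 hL hp hx hnonterm ht).
- exact: (min_abs_theta_le hF hOmegaK hOmegaC hD hL0 hL hp hx hnonterm ht).
Qed.
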